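(* Let $\nu\in\mathbb R$ with $|\nu|=1$, let $(s,s')=(0,-\frac12)$ and let $c,b,b'\in\mathbb R$. If $c>\frac12$, then the bilinear estimate $$\|uv\|_{X^{s,c-1}}\le C\,\|u\|_{X^{s,b}}\|v\|_{Y^{s',b'}}$$ fails, i.e. there is no constant $C>0$ for which it holds for all $u,v$.
   Context: Write $\langle\cdot\rangle=\sqrt{1+|\cdot|^2}$ and let $\widehat f(\tau,\xi)=\iint e^{-2\pi i(t\tau+x\xi)}f(t,x)\,dt\,dx$ be the space-time Fourier transform of complex-valued functions on $\mathbb R^2$ (variables $(t,x)$). For $s,a,s',a'\in\mathbb R$, the Bourgain spaces $X^{s,a}$ and $Y^{s',a'}=Y^{s',a'}_\nu$ are the completions of the Schwartz class $\mathcal S(\mathbb R^2)$ under the norms $$\|f\|_{X^{s,a}}=\|\langle\xi\rangle^s\langle\tau+\xi^2\rangle^a\widehat f(\tau,\xi)\|_{L^2_{\tau,\xi}},\qquad \|g\|_{Y^{s',a'}}=\|\langle\xi\rangle^{s'}\langle\tau+\nu|\xi|\xi\rangle^{a'}\widehat g(\tau,\xi)\|_{L^2_{\tau,\xi}} .$$ Here $u,v$ range over the Schwartz class $\mathcal S(\mathbb R^2)$ (dense in the spaces concerned). *)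

(* Defs.v *)
From HB Require Import structures.
From mathcomp Require Import all_boot all_order all_algebra.
From mathcomp Require Import complex.
From mathcomp Require Import all_classical all_reals all_analysis.

Set Implicit Arguments.
Unset Strict Implicit.
Unset Printing Implicit Defensive.

Import Order.TTheory GRing.Theory Num.Theory.
Import numFieldNormedType.Exports.

Local Open Scope classical_set_scope.
Local Open Scope ring_scope.

Notation lebesgue2 R := (@lebesgue_measure R \x @lebesgue_measure R)%E.

(* Points of the plane are (t, x) in physical space and (tau, xi) in frequency
   space.  [coord_dir R false] is the t-direction, [coord_dir R true] the
   x-direction. *)
Definition coord_dir (R : realType) (i : bool) : R * R :=
  if i then (0, 1) else (1, 0).

(* A word w of directions encodes an iterated partial derivative; the head of
   w is the last derivative taken. *)
Definition iter_partial (R : realType) (w : seq bool) (g : R * R -> R) :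
    R * R -> R :=
  foldr (fun i h => 'D_(coord_dir R i) h) g w.

(* The library's derivative is a total operator, so existence of each partial
   derivative is required separately. *)
Definition smooth2 (R : realType) (g : R * R -> R) : Prop :=
  forall w : seq bool,
    continuous (iter_partial w g) /\
    forall (i : bool) (p : R * R),
      derivable (iter_partial w g) p (coord_dir R i).

Definition rapidly_decreasing2 (R : realType) (g : R * R -> R) : Prop :=
  forall (w : seq bool) (k l : nat), exists M : R,
    forall t x : R, `|t ^+ k * x ^+ l * iter_partial w g (t, x)| <= M.

Definition schwartz2 (R : realType) (f : R * R -> R[i]) : Prop :=
  [/\ smooth2 (fun p => complex.Re (f p)),
      rapidly_decreasing2 (fun p => complex.Re (f p)),
      smooth2 (fun p => complex.Im (f p)) &
      rapidly_decreasing2 (fun p => complex.Im (f p))].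

Definition expi (R : realType) (theta : R) : R[i] :=
  Complex (cos theta) (sin theta).

(* Integral over R^2 of an integrable complex-valued function. *)
Definition cintegral2 (R : realType) (f : R * R -> R[i]) : R[i] :=
  Complex (\int[lebesgue2 R]_p complex.Re (f p))
          (\int[lebesgue2 R]_p complex.Im (f p)).

Definition fourier2 (R : realType) (f : R * R -> R[i]) (tau xi : R) : R[i] :=
  cintegral2 (fun p => expi (- (2 * pi * (p.1 * tau + p.2 * xi))) * f p).

Definition bracket (R : realType) (x : R) : R := Num.sqrt (1 + `|x| ^+ 2).

Definition Xnorm (R : realType) (s a : R) (f : R * R -> R[i]) : \bar R :=
  Lnorm (lebesgue2 R) 2%:E
    (fun q : R * R => let: (tau, xi) := q in
      (bracket xi `^ s * bracket (tau + xi ^+ 2) `^ a *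
       ComplexField.Normc.normc (fourier2 f tau xi))%:E).

Definition Ynorm (R : realType) (nu s a : R) (g : R * R -> R[i]) : \bar R :=
  Lnorm (lebesgue2 R) 2%:E
    (fun q : R * R => let: (tau, xi) := q in
      (bracket xi `^ s * bracket (tau + nu * `|xi| * xi) `^ a *
       ComplexField.Normc.normc (fourier2 g tau xi))%:E).

(* Main.v *)
(* Resonant interaction.  For P = nu N with N large, take for u the Gaussian
   exp(- t^2 - (x - 2 P t)^2), carried at the Schrodinger group velocity 2 P,
   modulated by exp(2 pi i (P x - P^2 t)), and for v the same Gaussian with the
   conjugate modulation.  The transform of u is a Gaussian in
   sigma = tau + 2 P xi - P^2 and eta = xi - P, where
   tau + xi^2 = sigma + eta^2; the transform of v is a Gaussian in
   sigma = tau + 2 P xi + P^2 and eta = xi + P, where tau - xi^2 = sigma - eta^2,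
   and nu |xi| xi = - xi^2 near xi = - P.  Hence, whatever b and b' are,
   ||u||_X <~ 1 and ||v||_Y <~ N^(-1/2).  In the product the phases cancel: u v
   is a Gaussian of frequency O(1) whose modulation
   tau + xi^2 = sigma - 2 P xi + xi^2 is O(N), so that
   ||u v||_X >~ N^(- max(0, 1 - c)).  For c > 1/2 this beats N^(-1/2). *)
Require Import Defs.
From HB Require Import structures.
From mathcomp Require Import all_boot all_order all_algebra.
From mathcomp Require Import complex.
From mathcomp Require Import all_classical all_reals all_analysis.
From mathcomp Require Import measurable_realfun ring lra.

Set Implicit Arguments.
Unset Strict Implicit.
Unset Printing Implicit Defensive.

Import Order.TTheory GRing.Theory Num.Theory.
Import numFieldNormedType.Exports.

Local Open Scope classical_set_scope.
Local Open Scope ring_scope.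

(** * Schwartz functions *)

(** Restriction to the line through [p] in direction [v] makes the one-variable chain rule available
    for directional derivatives. *)
Lemma is_derive_line (R : realType) (f : R * R -> R) (p v : R * R) (df : R) :
  is_derive p v f df <-> is_derive (0 : R) 1 (fun h : R => f (h *: v + p)) df.
Proof.
have E : (fun h : R => h^-1 *: ((f \o shift p) (h *: v) - f p)) =
         (fun h : R => h^-1 *: (((fun h : R => f (h *: v + p)) \o shift 0)
           (h *: 1) - f (0 *: v + p))).
  apply/funext => h /=; congr (_ *: (f (_ + _) - f _)).
    by rewrite addr0 [h *: 1]mulr1.
  by rewrite scale0r add0r.
split=> -[d dv]; split.
- by rewrite /derivable -E.
- by rewrite -dv /derive -E.
- by rewrite /derivable E.
- by rewrite -dv /derive E.
Qed.

Lemma is_derive_dir_comp (R : realType) (phi : R -> R) (g : R * R -> R)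
    (p v : R * R) (a b : R) :
  is_derive (g p) 1 phi a -> is_derive p v g b ->
  is_derive p v (phi \o g) (a * b).
Proof.
move=> dphi /is_derive_line dg; apply/is_derive_line.
apply: (@is_derive1_comp _ phi (fun h => g (h *: v + p))) dg.
by rewrite scale0r add0r.
Qed.

Lemma is_derive_dir_fst (R : realType) (p v : R * R) :
  is_derive p v (fst : R * R -> R) v.1.
Proof.
apply/is_derive_line => /=.
have -> : (fun h : R => h *: v.1 + p.1) = cst v.1 * id + cst p.1.
  by apply/funext => h; rewrite [h *: _]mulrC.
apply: is_derive_eq (is_deriveD (is_deriveM (is_derive_cst (v.1 : R) (0 : R) (1 : R))
  (is_derive_id _ _)) (is_derive_cst (p.1 : R) _ _)) _.
by rewrite /= [_ *: 1]mulr1 [_ *: 0]mulr0 !addr0.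
Qed.

Lemma is_derive_dir_snd (R : realType) (p v : R * R) :
  is_derive p v (snd : R * R -> R) v.2.
Proof.
apply/is_derive_line => /=.
have -> : (fun h : R => h *: v.2 + p.2) = cst v.2 * id + cst p.2.
  by apply/funext => h; rewrite [h *: _]mulrC.
apply: is_derive_eq (is_deriveD (is_deriveM (is_derive_cst (v.2 : R) (0 : R) (1 : R))
  (is_derive_id _ _)) (is_derive_cst (p.2 : R) _ _)) _.
by rewrite /= [_ *: 1]mulr1 [_ *: 0]mulr0 !addr0.
Qed.

(** An inductive closure, so that stability under derivation, continuity and polynomial growth each
    follow by induction on the constructors. *)
Inductive poly2 (R : realType) : (R * R -> R) -> Prop :=
| poly2_cst c : poly2 (cst c)
| poly2_fst : poly2 fst
| poly2_snd : poly2 snd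
| poly2D f g : poly2 f -> poly2 g -> poly2 (f + g)
| poly2M f g : poly2 f -> poly2 g -> poly2 (f * g).

Lemma poly2_derive (R : realType) (f : R * R -> R) (v : R * R) : poly2 f ->
  exists2 f', poly2 f' & forall p, is_derive p v f (f' p).
Proof.
elim=> [c|||g h pg [g' pg' dg] ph [h' ph' dh]|g h pg [g' pg' dg] ph [h' ph' dh]].
- by exists (cst 0); [exact: poly2_cst|move=> p; exact: is_derive_cst].
- by exists (cst v.1); [exact: poly2_cst|move=> p; exact: is_derive_dir_fst].
- by exists (cst v.2); [exact: poly2_cst|move=> p; exact: is_derive_dir_snd].
- by exists (g' + h'); [exact: poly2D|move=> p; exact: is_deriveD].
- exists (g * h' + h * g'); first by apply: poly2D; exact: poly2M.
  by move=> p; exact: is_deriveM.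
Qed.

Lemma poly2_continuous (R : realType) (f : R * R -> R) : poly2 f -> continuous f.
Proof.
elim=> [c|||g h pg cg ph ch|g h pg cg ph ch] p.
- exact: cvg_cst.
- exact: cvg_fst.
- exact: cvg_snd.
- by apply: cvgD; [exact: cg|exact: ch].
- by apply: cvgM; [exact: cg|exact: ch].
Qed.

(** When [Q] and [phi] are polynomial, this class is stable under partial derivatives. One invariant
    thus covers all iterated derivatives of both the real and the imaginary part of a modulated
    Gaussian. *)
Definition oscillating (R : realType) (Q phi g : R * R -> R) : Prop :=
  exists p q, [/\ poly2 p, poly2 q &
    g = (expR \o Q) * (p * (@cos R \o phi) + q * (@sin R \o phi))].

Lemma oscillating_derive (R : realType) (Q phi g : R * R -> R) (v : R * R) :
  poly2 Q -> poly2 phi -> oscillating Q phi g ->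
  exists2 g', oscillating Q phi g' & forall z, is_derive z v g (g' z).
Proof.
move=> /(poly2_derive v)[Q' pQ' dQ] /(poly2_derive v)[f' pf' df].
move=> [p [q [pp pq ->]]].
have /(poly2_derive v)[p' pp' dp] := pp.
have /(poly2_derive v)[q' pq' dq] := pq.
(* Differentiating the phase exchanges cosine and sine: [q * f'] joins the cosine coefficient and
   [- p * f'] the sine coefficient. *)
exists ((expR \o Q) * ((Q' * p + p' + q * f') * (@cos R \o phi) +
                       (Q' * q + q' + cst (-1) * (p * f')) * (@sin R \o phi))).
  exists (Q' * p + p' + q * f'), (Q' * q + q' + cst (-1) * (p * f')).
  by split => //; repeat apply: poly2D => //; repeat apply: poly2M => //;
    exact: poly2_cst.
move=> z.
have dE := is_derive_dir_comp (is_derive_expR (Q z)) (dQ z).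
have dc := is_derive_dir_comp (is_derive_cos (phi z)) (df z).
have ds := is_derive_dir_comp (is_derive_sin (phi z)) (df z).
apply: is_derive_eq (is_deriveM dE (is_deriveD (is_deriveM (dp z) dc)
  (is_deriveM (dq z) ds))) _.
rewrite /= /GRing.scale/= !fctE /=; ring.
Qed.

Lemma oscillating_continuous (R : realType) (Q phi g : R * R -> R) :
  poly2 Q -> poly2 phi -> oscillating Q phi g -> continuous g.
Proof.
move=> pQ pphi [p [q [pp pq ->]]] z.
have cQ := poly2_continuous pQ; have cphi := poly2_continuous pphi.
apply: cvgM.
  by apply: continuous_comp; [exact: cQ|exact: continuous_expR].
apply: cvgD; apply: cvgM; try exact: poly2_continuous.
  by apply: continuous_comp; [exact: cphi|exact: continuous_cos].
by apply: continuous_comp; [exact: cphi|exact: continuous_sin].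
Qed.

Lemma iter_partial_oscillating (R : realType) (Q phi g : R * R -> R) w :
  poly2 Q -> poly2 phi -> oscillating Q phi g ->
  oscillating Q phi (iter_partial w g).
Proof.
move=> pQ pphi og; elim: w => //= i w /(oscillating_derive (coord_dir R i) pQ pphi).
move=> [g' og' dg]; rewrite -/(iter_partial w g).
suff -> : 'D_(coord_dir R i) (iter_partial w g) = g' by [].
by apply/funext => z; exact: derive_val.
Qed.

Lemma oscillating_smooth (R : realType) (Q phi g : R * R -> R) :
  poly2 Q -> poly2 phi -> oscillating Q phi g -> smooth2 g.
Proof.
move=> pQ pphi og w; have ow := iter_partial_oscillating w pQ pphi og.
split; first exact: oscillating_continuous ow.
move=> i z; have [g' _ dg] := oscillating_derive (coord_dir R i) pQ pphi ow.
exact: ex_derive.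
Qed.

Lemma exprn_le_expR (R : realType) (n : nat) (x : R) :
  0 <= x -> x ^+ n <= n`!%:R * expR x.
Proof.
case: n => [|n] x0; first by rewrite expr0 fact0 mul1r -expR0 ler_expR.
rewrite -ler_pdivrMl ?ltr0n ?fact_gt0// mulrC.
by apply: le_trans (expR_ge1Dxn n x0); rewrite lerDr.
Qed.

Definition shear_sq (R : realType) (m : R) (z : R * R) : R :=
  z.1 ^+ 2 + (z.2 - m * z.1) ^+ 2.

Lemma shear_sq_ge0 (R : realType) (m : R) z : 0 <= shear_sq m z.
Proof. by rewrite addr_ge0 ?sqr_ge0. Qed.

Lemma ler_norm_1Dsqr (R : realType) (x : R) : `|x| <= 1 + x ^+ 2.
Proof.
rewrite -(real_normK (num_real x)).
by have := sqr_ge0 (`|x| - 2^-1); have := normr_ge0 x; nra.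
Qed.

(** The shear is invertible: [x = (x - m t) + m t]. Both coordinates are therefore controlled by
    [1 + shear_sq m z], and this weight is at least 1, so its powers can be raised to a common
    exponent in sums. *)
Lemma poly2_growth (R : realType) (m : R) (f : R * R -> R) : poly2 f ->
  exists C n, 0 <= C /\ forall z, `|f z| <= C * (1 + shear_sq m z) ^+ n.
Proof.
have W1 z : 1 <= 1 + shear_sq m z by rewrite lerDl shear_sq_ge0.
have W0 z : 0 <= 1 + shear_sq m z by rewrite (le_trans ler01).
elim=> [c|||g h _ [C [n [C0 Cn]]] _ [D [k [D0 Dk]]]|
  g h _ [C [n [C0 Cn]]] _ [D [k [D0 Dk]]]].
- by exists `|c|, 0; split => // z; rewrite expr0 mulr1.
- exists 1, 1%N; split => // z; rewrite mul1r expr1.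
  by apply: le_trans (ler_norm_1Dsqr _) _; rewrite lerD2l lerDl sqr_ge0.
- exists (1 + `|m|), 1%N; split => [|z]; first by rewrite addr_ge0.
  rewrite expr1 mulrDl mul1r.
  rewrite -[z.2](subrK (m * z.1)) (le_trans (ler_normD _ _))// lerD//.
    apply: le_trans (ler_norm_1Dsqr _) _.
    by rewrite lerD2l /shear_sq lerDr sqr_ge0.
  rewrite normrM ler_wpM2l//.
  apply: le_trans (ler_norm_1Dsqr _) _.
  by rewrite lerD2l /shear_sq lerDl sqr_ge0.
- exists (C + D), (n + k)%N; split => [|z]; first by rewrite addr_ge0.
  rewrite (le_trans (ler_normD _ _))// mulrDl lerD//.
    by rewrite (le_trans (Cn z))// ler_wpM2l// ler_weXn2l// leq_addr.
  by rewrite (le_trans (Dk z))// ler_wpM2l// ler_weXn2l// leq_addl.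
- exists (C * D), (n + k)%N; split => [|z]; first by rewrite mulr_ge0.
  by rewrite normrM exprD mulrACA ler_pM.
Qed.

Definition gauss_exponent (R : realType) (a m : R) (z : R * R) : R :=
  - a * shear_sq m z.

Lemma poly2_gauss_exponent (R : realType) (a m : R) : poly2 (gauss_exponent a m).
Proof.
have -> : gauss_exponent a m = cst (- a) * (fst * fst +
    (snd + cst (- m) * fst) * (snd + cst (- m) * fst)).
  by apply/funext => z; rewrite /gauss_exponent /shear_sq !fctE; ring.
repeat (apply: poly2D || apply: poly2M); try exact: poly2_cst;
  try exact: poly2_fst; exact: poly2_snd.
Qed.

Lemma poly2X (R : realType) (f : R * R -> R) n : poly2 f -> poly2 (f ^+ n).
Proof.
move=> pf; elim: n => [|n IHn]; first by rewrite expr0; exact: (poly2_cst 1).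
by rewrite exprS; exact: poly2M.
Qed.

(** Every derivative, multiplied by a monomial, is a polynomially bounded factor times the same
    Gaussian, which absorbs any power of [1 + shear_sq m z]. *)
Lemma oscillating_decay (R : realType) (a m : R) (phi g : R * R -> R) :
  0 < a -> poly2 phi -> oscillating (gauss_exponent a m) phi g ->
  rapidly_decreasing2 g.
Proof.
move=> a0 pphi og w k l.
have := iter_partial_oscillating w (poly2_gauss_exponent a m) pphi og.
move=> [p [q [pp pq ->]]].
have [C [n [C0 Cn]]] : exists C n, 0 <= C /\ forall z,
   `|(fst ^+ k * snd ^+ l * (p * (@cos R \o phi) + q * (@sin R \o phi))) z| <=
      C * (1 + shear_sq m z) ^+ n.
  have pkl : poly2 (fst ^+ k * snd ^+ l : R * R -> R).
    by apply: poly2M; apply: poly2X; [exact: poly2_fst|exact: poly2_snd].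
  have [C [n [C0 Cn]]] := poly2_growth m (poly2M pkl pp).
  have [D [j [D0 Dj]]] := poly2_growth m (poly2M pkl pq).
  have W1 z : 1 <= 1 + shear_sq m z by rewrite lerDl shear_sq_ge0.
  exists (C + D), (n + j)%N; split => [|z]; first by rewrite addr_ge0.
  rewrite mulrDr !mulrA (le_trans (ler_normD _ _))// mulrDl lerD//.
    rewrite [X in X <= _]normrM.
    apply: (@le_trans _ _ (C * (1 + shear_sq m z) ^+ n)); last first.
      by rewrite ler_wpM2l// ler_weXn2l// leq_addr.
    by rewrite -[leRHS]mulr1 ler_pM// ler_norml cos_geN1 cos_le1.
  rewrite [X in X <= _]normrM.
  apply: (@le_trans _ _ (D * (1 + shear_sq m z) ^+ j)); last first.
    by rewrite ler_wpM2l// ler_weXn2l// leq_addl.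
  by rewrite -[leRHS]mulr1 ler_pM// ler_norml sin_geN1 sin_le1.
(* With [W] the value of [shear_sq], one term of the exponential series gives
   [(a (1 + W))^n <= n! exp(a (1 + W))]; multiplying by [exp(- a W)] leaves [exp a]. *)
exists (C * (a^-1 ^+ n * n`!%:R * expR a)) => t x.
have -> : t ^+ k * x ^+ l * ((expR \o gauss_exponent a m) *
     (p * (@cos R \o phi) + q * (@sin R \o phi))) (t, x) =
     (fst ^+ k * snd ^+ l * (p * (@cos R \o phi) + q * (@sin R \o phi))) (t, x)
     * expR (gauss_exponent a m (t, x)).
  by rewrite !fctE /=; ring.
rewrite normrM (ger0_norm (expR_ge0 _)).
apply: (@le_trans _ _ (C * (1 + shear_sq m (t, x)) ^+ n *
    expR (gauss_exponent a m (t, x)))).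
  by rewrite ler_wpM2r ?expR_ge0.
rewrite -!mulrA ler_wpM2l//.
set W := shear_sq _ _; have W0 : 0 <= W by exact: shear_sq_ge0.
have aW0 : 0 <= a * (1 + W) by apply: mulr_ge0; [exact: ltW|exact: addr_ge0].
have := exprn_le_expR n aW0.
rewrite exprMn -ler_pdivlMl ?exprn_gt0// => le1.
apply: (@le_trans _ _ (a ^- n * (n`!%:R * expR (a * (1 + W))) *
    expR (gauss_exponent a m (t, x)))).
  by rewrite ler_wpM2r ?expR_ge0.
rewrite exprVn -!mulrA ler_wpM2l ?invr_ge0 ?exprn_ge0 ?(ltW a0)//.
rewrite ler_wpM2l// -expRD ler_expR /gauss_exponent -/W.
by rewrite le_eqVlt; apply/orP; left; apply/eqP; ring.
Qed.

(** This is [exp(- a shear_sq + i (al t + be x))]. Here [al] and [be] are angular frequencies,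
    whence the factors [2 * pi] wherever a packet is centred at a given point of the frequency
    plane. *)
Definition wave_packet (R : realType) (a m al be : R) (z : R * R) : R[i] :=
  Complex (expR (gauss_exponent a m z) * cos (al * z.1 + be * z.2))
          (expR (gauss_exponent a m z) * sin (al * z.1 + be * z.2)).

Lemma wave_packet_schwartz (R : realType) (a m al be : R) :
  0 < a -> schwartz2 (wave_packet a m al be).
Proof.
move=> a0; pose phi := cst al * fst + cst be * snd : R * R -> R.
have pphi : poly2 phi.
  apply: poly2D; apply: poly2M; try exact: poly2_cst.
    exact: poly2_fst.
  exact: poly2_snd.
have pQ := poly2_gauss_exponent a m.
have oR : oscillating (gauss_exponent a m) phi
    (fun z => complex.Re (wave_packet a m al be z)).
  exists (cst 1), (cst 0); split; try exact: poly2_cst.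
  by apply/funext => z; rewrite /= !fctE /= mul1r mul0r addr0.
have oI : oscillating (gauss_exponent a m) phi
    (fun z => complex.Im (wave_packet a m al be z)).
  exists (cst 0), (cst 1); split; try exact: poly2_cst.
  by apply/funext => z; rewrite /= !fctE /= mul1r mul0r add0r.
split; [exact: oscillating_smooth oR|exact: oscillating_decay oR|
  exact: oscillating_smooth oI|exact: oscillating_decay oI].
Qed.

(** * Fourier transforms of Gaussians *)

(** Lebesgue measure is determined by its values on half-open intervals, and a shift pulls such an
    interval back to one of equal length. *)
Lemma lebesgue_measure_shift (R : realType) (c : R) (A : set R) : measurable A ->
  pushforward lebesgue_measure ((fun x => x + c) : _ -> measurableTypeR R) A =
  lebesgue_measure A.
Proof.
move=> mA; apply/esym/lebesgue_measure_unique => //=.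
  by apply: measurable_funD.
move=> _ _ [[a b] /= _ <-].
rewrite /pushforward.
have -> : (fun x => x + c) @^-1` `]a, b]%classic = `](a - c), (b - c)]%classic.
  apply/seteqP; split => x /=; rewrite !in_itv/= ltrBlDr lerBrDr//.
rewrite !lebesgue_measure_itv/= !lte_fin ltrD2r.
by case: ifP => // _; rewrite -!EFinB; congr EFin; lra.
Qed.

Lemma ge0_integral_lebesgue_shift (R : realType) (f : R -> \bar R) (c : R) :
  measurable_fun [set: R] f -> (forall x, 0 <= f x)%E ->
  (\int[lebesgue_measure]_x f (x + c)%R = \int[lebesgue_measure]_x f x)%E.
Proof.
move=> mf f0; symmetry.
transitivity (\int[pushforward lebesgue_measure
    ((fun x => x + c)%R : _ -> measurableTypeR R)]_x f x)%E.
  apply: eq_measure_integral => [|mshift A mA _]; first exact: measurable_funD.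
  exact/esym/lebesgue_measure_shift.
by rewrite ge0_integral_pushforward//; exact: measurable_funD.
Qed.

Lemma integral_lebesgue_shift (R : realType) (f : R -> \bar R) (c : R) :
  measurable_fun [set: R] f ->
  (\int[lebesgue_measure]_x f (x + c)%R = \int[lebesgue_measure]_x f x)%E.
Proof.
move=> mf; rewrite [LHS]integralE [RHS]integralE; congr (_ - _)%E.
  rewrite -(ge0_integral_lebesgue_shift c (measurable_funepos mf) (@funepos_ge0 _ _ f)).
  by apply: eq_integral => x _; rewrite !funeposE.
rewrite -(ge0_integral_lebesgue_shift c (measurable_funeneg mf) (@funeneg_ge0 _ _ f)).
by apply: eq_integral => x _; rewrite !funenegE.
Qed.

Lemma gauss_normal_fun (R : realType) (a : R) : 0 < a ->
  (fun x : R => expR (- a * x ^+ 2)) = normal_fun 0 (Num.sqrt (2 * a)^-1).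
Proof.
move=> a0; apply/funext => x; rewrite /normal_fun subr0.
rewrite sqr_sqrtr ?invr_ge0 ?mulr_ge0 ?(ltW a0)//.
congr expR; rewrite -mulr_natr; field.
by rewrite gt_eqF.
Qed.

(** The Gaussian is proportional to the centred normal density of variance [1 / (2 a)]; its
    integrability and the positivity of its integral are inherited from that density. *)
Lemma normal_pdf_gauss (R : realType) (a : R) : 0 < a ->
  exists2 k : R, 0 < k &
    normal_pdf 0 (Num.sqrt (2 * a)^-1) = (fun x => k * expR (- a * x ^+ 2)).
Proof.
move=> a0; set s := Num.sqrt _.
have s0 : s != 0 by rewrite gt_eqF// sqrtr_gt0 invr_gt0 mulr_gt0.
exists (normal_peak s); first exact: normal_peak_gt0.
by rewrite normal_pdfE//; apply/funext => x; rewrite -(gauss_normal_fun a0).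
Qed.

Lemma integrable_gauss (R : realType) (a : R) : 0 < a ->
  lebesgue_measure.-integrable setT (EFin \o (fun x : R => expR (- a * x ^+ 2))).
Proof.
move=> a0; have [k k0 kE] := normal_pdf_gauss a0.
have := integrable_normal_pdf 0 (Num.sqrt (2 * a)^-1).
move=> /(integrableZl measurableT k^-1); rewrite kE.
by apply: eq_integrable => // x _; rewrite -EFinM mulKf ?gt_eqF.
Qed.

(** This number is [sqrt (pi / a)]; it enters the estimates only as a positive constant. *)
Definition gauss_mass (R : realType) (a : R) : R :=
  \int[lebesgue_measure]_x expR (- a * x ^+ 2).

Lemma gauss_mass_gt0 (R : realType) (a : R) : 0 < a -> 0 < gauss_mass a.
Proof.
move=> a0; have [k k0 kE] := normal_pdf_gauss a0.
have : \int[lebesgue_measure]_x normal_pdf 0 (Num.sqrt (2 * a)^-1) x = 1 :> R.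
  by rewrite /Rintegral integral_normal_pdf.
rewrite kE RintegralZl//; last exact: integrable_gauss.
by rewrite -/(gauss_mass a) => h; rewrite -(pmulr_rgt0 _ k0) h.
Qed.

(* Differentiates the constant function c |-> \int f (x + c) dx. *)
Lemma Rintegral_derive_eq0 (R : realType) (f f' G : R -> R) :
  (forall x : R, is_derive x 1 f (f' x)) ->
  lebesgue_measure.-integrable setT (EFin \o f) ->
  lebesgue_measure.-integrable setT (EFin \o G) ->
  (forall c x : R, -1 < c < 1 -> `|f' (x + c)| <= G x) ->
  \int[lebesgue_measure]_x f' x = 0.
Proof.
move=> df intf intG f'G.
pose F (c x : R) := f (x + c).
have mf : measurable_fun [set: R] (EFin \o f) by exact: measurable_int intf.
have dF (x c : R) : is_derive c 1 (F^~ x) (f' (x + c)).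
  have dx : is_derive c 1 (fun c : R => x + c) 1.
    by apply: is_derive_eq (is_deriveD (is_derive_cst x _ _) (is_derive_id _ _)) _; rewrite add0r.
  by apply: is_derive_eq (is_derive1_comp (df (x + c)) dx) _; rewrite mulr1.
have p1 c x : partial1of2 F c x = f' (x + c).
  by rewrite partial1of2E; have := dF x c => -[].
have Fcst c : \int[lebesgue_measure]_x F c x = \int[lebesgue_measure]_x f x.
  by rewrite /Rintegral -(integral_lebesgue_shift c mf).
have G0 x : 0 <= G x.
  by apply: le_trans (f'G 0 x _); rewrite ?normr_ge0// ltrN10 ltr01.
have := @differentiation_under_integral R _ _ lebesgue_measure F setT measurableT 0 (-1) 1.
rewrite /= in_itv/= ltrN10 ltr01 => /(_ isT).
move=> /(_ _ _ G G0 intG).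
have -> : (fun c => \int[lebesgue_measure]_x F c x) =
    cst (\int[lebesgue_measure]_x f x) by apply/funext => c; exact: Fcst.
rewrite derive1_cst => ->//.
- by apply: eq_Rintegral => x _; rewrite p1 addr0.
- move=> c _; have mFc : measurable_fun [set: R] (EFin \o F c).
    apply: (measurableT_comp mf) => //; exact: measurable_funD.
  apply/integrableP; split => //.
  have /integrableP[_] := intf; rewrite -(integral_lebesgue_shift c)//.
  exact: measurableT_comp.
- by move=> c x; rewrite in_itv/= => c1 _; rewrite p1 f'G.
Qed.

(** * Oscillatory Gaussian integrals on the line *)

Lemma integrable_gauss_le (R : realType) (a K : R) (f : R -> R) : 0 < a ->
  measurable_fun [set: R] f -> (forall x, `|f x| <= K * expR (- a * x ^+ 2)) ->
  lebesgue_measure.-integrable setT (EFin \o f).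
Proof.
move=> a0 mf fK.
apply: le_integrable (integrableZl measurableT K (integrable_gauss a0)) => //.
  exact/measurable_EFinP.
by move=> x _; rewrite /= lee_fin (le_trans (fK x))// ler_norm.
Qed.

Lemma norm_cos_le1 (R : realType) (x : R) : `|cos x| <= 1.
Proof. by rewrite ler_norml cos_geN1 cos_le1. Qed.

Lemma norm_sin_le1 (R : realType) (x : R) : `|sin x| <= 1.
Proof. by rewrite ler_norml sin_geN1 sin_le1. Qed.

(** Half of the exponent pays for the linear factor: [|y| <= 1 + y^2 <= (1 + 2/a) (1 + a y^2 / 2) <=
    (1 + 2/a) exp(a y^2 / 2)]. *)
Lemma norm_mul_gauss_le (R : realType) (a y : R) : 0 < a ->
  `|y| * expR (- a * y ^+ 2) <= (1 + 2 / a) * expR (- (a / 2) * y ^+ 2).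
Proof.
move=> a0.
have -> : - a * y ^+ 2 = - (a / 2 * y ^+ 2) + - (a / 2) * y ^+ 2 by field.
rewrite expRD mulrA ler_wpM2r ?expR_ge0// expRN ler_pdivrMr ?expR_gt0//.
have z0 : 0 <= a / 2 * y ^+ 2 by rewrite mulr_ge0 ?sqr_ge0 ?divr_ge0// ltW.
have h := expR_ge1Dx (a / 2 * y ^+ 2).
apply: (@le_trans _ _ ((1 + 2 / a) * (1 + a / 2 * y ^+ 2))).
  apply: le_trans (ler_norm_1Dsqr y) _.
  have -> : (1 + 2 / a) * (1 + a / 2 * y ^+ 2) =
      1 + y ^+ 2 + (2 / a + a / 2 * y ^+ 2) by field; rewrite gt_eqF.
  by rewrite lerDl addr_ge0// divr_ge0// ltW.
by rewrite ler_wpM2l// addr_ge0// divr_ge0// ltW.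
Qed.

Lemma gauss_translate_le (R : realType) (a c x : R) : 0 < a -> -1 < c < 1 ->
  expR (- a * (x + c) ^+ 2) <= expR a * expR (- (a / 2) * x ^+ 2).
Proof.
move=> a0 c1; rewrite -expRD ler_expR.
(* Completing the square: this is twice the difference of the two exponents. *)
have : 0 <= a * ((x + 2 * c) ^+ 2 + 2 * (1 - c ^+ 2)).
  rewrite mulr_ge0 ?(ltW a0)// addr_ge0 ?sqr_ge0// mulr_ge0//; nra.
lra.
Qed.

Lemma measurable_cos_gauss (R : realType) (a B th : R) :
  measurable_fun [set: R] (fun x => cos (B * x + th) * expR (- a * x ^+ 2)).
Proof.
apply: measurable_funM.
  apply: (measurableT_comp (continuous_measurable_fun (@continuous_cos R))).
  by apply: measurable_funD => //; exact: measurable_funM.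
by apply: measurableT_comp => //; exact: measurable_funM.
Qed.

Lemma integrable_cos_gauss (R : realType) (a B th : R) : 0 < a ->
  lebesgue_measure.-integrable setT
    (EFin \o (fun x : R => cos (B * x + th) * expR (- a * x ^+ 2))).
Proof.
move=> a0; apply: (integrable_gauss_le (K := 1)) a0 _ _.
  exact: measurable_cos_gauss.
move=> x; rewrite normrM (ger0_norm (expR_ge0 _)).
by rewrite ler_wpM2r ?expR_ge0 ?norm_cos_le1.
Qed.

Lemma is_derive_affine (R : realType) (B th x : R) :
  is_derive x 1 (fun x => B * x + th) B.
Proof.
apply: is_derive_eq (is_deriveD (is_deriveM (is_derive_cst B x 1)
  (is_derive_id _ _)) (is_derive_cst th _ _)) _.
by rewrite /= [_ *: 1]mulr1 [_ *: 0]mulr0 !addr0.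
Qed.

Lemma is_derive_gauss (R : realType) (a x : R) :
  is_derive x 1 (fun x => expR (- a * x ^+ 2)) (- (2 * a * x) * expR (- a * x ^+ 2)).
Proof.
have dq : is_derive x 1 (fun x => - a * x ^+ 2) (- (2 * a * x)).
  apply: is_derive_eq (is_deriveM (is_derive_cst (- a) x 1)
    (is_deriveX 2 (is_derive_id x 1))) _.
  by rewrite /= /GRing.scale/=; ring.
by apply: is_derive_eq (is_derive1_comp (is_derive_expR _) dq) _; rewrite mulrC.
Qed.

Lemma measurable_mulx_sin_gauss (R : realType) (a B th : R) :
  measurable_fun [set: R]
    (fun x => x * sin (B * x + th) * expR (- a * x ^+ 2)).
Proof.
apply: measurable_funM.
  apply: measurable_funM => //.
  apply: (measurableT_comp (continuous_measurable_fun (@continuous_sin R))).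
  by apply: measurable_funD => //; exact: measurable_funM.
by apply: measurableT_comp => //; exact: measurable_funM.
Qed.

Lemma mulx_sin_gauss_le (R : realType) (a B th x : R) : 0 < a ->
  `|x * sin (B * x + th) * expR (- a * x ^+ 2)| <=
  (1 + 2 / a) * expR (- (a / 2) * x ^+ 2).
Proof.
move=> a0; rewrite !normrM (ger0_norm (expR_ge0 _)).
apply: le_trans (norm_mul_gauss_le x a0).
rewrite ler_wpM2r ?expR_ge0//.
by rewrite -[leRHS]mulr1 ler_wpM2l// norm_sin_le1.
Qed.

Lemma integrable_mulx_sin_gauss (R : realType) (a B th : R) : 0 < a ->
  lebesgue_measure.-integrable setT
    (EFin \o (fun x : R => x * sin (B * x + th) * expR (- a * x ^+ 2))).
Proof.
move=> a0; have a20 : 0 < a / 2 by rewrite divr_gt0.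
apply: (integrable_gauss_le (K := 1 + 2 / a)) a20 _ _.
  exact: measurable_mulx_sin_gauss.
by move=> x; exact: mulx_sin_gauss_le.
Qed.

(** Integration by parts, in the form that the derivative of [sin (B x + th) exp(- a x^2)] has
    integral zero. *)
Lemma Rintegral_mulx_sin_gauss (R : realType) (a B th : R) : 0 < a ->
  \int[lebesgue_measure]_x (x * sin (B * x + th) * expR (- a * x ^+ 2)) =
  B / (2 * a) *
    \int[lebesgue_measure]_x (cos (B * x + th) * expR (- a * x ^+ 2)).
Proof.
move=> a0.
have a20 : 0 < a / 2 by rewrite divr_gt0.
have a40 : 0 < a / 2 / 2 by rewrite divr_gt0.
pose C x := cos (B * x + th) * expR (- a * x ^+ 2).
pose S x := x * sin (B * x + th) * expR (- a * x ^+ 2).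
(* The derivative is at most [|B| + 2 a |y|] times the Gaussian at [y = x + c]. Absorbing [|y|]
   lowers the rate to [a / 2]; undoing the translation costs [exp(a / 2)] and lowers it to
   [a / 4]. *)
pose K := (`|B| + 2 * a * (1 + 2 / a)) * expR (a / 2).
have K0 : 0 <= 2 * a * (1 + 2 / a).
  by rewrite mulr_ge0// ?addr_ge0// ?divr_ge0// ?mulr_ge0// ltW.
have iC := integrable_cos_gauss B th a0; have iS := integrable_mulx_sin_gauss B th a0.
have : \int[lebesgue_measure]_x (B * C x - 2 * a * S x) = 0.
  apply: (@Rintegral_derive_eq0 _ (fun x => sin (B * x + th) * expR (- a * x ^+ 2))
    _ (fun x => K * expR (- (a / 2 / 2) * x ^+ 2))).
  - move=> x.
    have ds := @is_derive1_comp _ (@sin R) (fun x => B * x + th) x _ _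
      (is_derive_sin _) (is_derive_affine B th x).
    apply: is_derive_eq (is_deriveM ds (is_derive_gauss a x)) _.
    by rewrite /= /GRing.scale/= /C /S; ring.
  (* A sine is a cosine with its phase moved by [pi / 2]. *)
  - have := integrable_cos_gauss B (th - pi / 2) a0.
    apply: eq_integrable => // x _ /=; congr (_ * _)%:E.
    by rewrite addrA -[B * x + th in RHS](subrK (pi / 2)) sinDpihalf.
  - exact: integrableZl (integrable_gauss a40).
  move=> c x c1.
  apply: (@le_trans _ _ ((`|B| + 2 * a * (1 + 2 / a)) *
      expR (- (a / 2) * (x + c) ^+ 2))); last first.
    rewrite /K -[leRHS]mulrA ler_wpM2l ?addr_ge0//.
    exact: gauss_translate_le.
  rewrite (le_trans (ler_normB _ _))// [leRHS]mulrDl lerD//.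
    rewrite !normrM ler_wpM2l// (ger0_norm (expR_ge0 _)) -[leRHS]mul1r.
    rewrite ler_pM ?expR_ge0 ?norm_cos_le1// ler_expR.
    by rewrite ler_wpM2r ?sqr_ge0// lerN2; lra.
  rewrite normrM ger0_norm ?mulr_ge0 ?(ltW a0)// -[leRHS]mulrA.
  by rewrite ler_wpM2l ?mulr_ge0 ?(ltW a0)// mulx_sin_gauss_le.
rewrite RintegralB//; first last.
- exact: (integrableZl measurableT (2 * a) iS).
- exact: (integrableZl measurableT B iC).
rewrite RintegralZl// RintegralZl// => /eqP; rewrite subr_eq0 => /eqP h.
rewrite mulrAC h; field.
by rewrite gt_eqF.
Qed.

(** Differentiation under the integral, with a dominating function independent of [B], followed by
    the integration by parts above. The outcome is the linear equation [F' = - (B / (2 a)) F]. *)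
Lemma is_derive_Rintegral_cos_gauss (R : realType) (a B th : R) : 0 < a ->
  is_derive B 1
    (fun B => \int[lebesgue_measure]_x (cos (B * x + th) * expR (- a * x ^+ 2)))
    (- (B / (2 * a)) *
      \int[lebesgue_measure]_x (cos (B * x + th) * expR (- a * x ^+ 2))).
Proof.
move=> a0; have a20 : 0 < a / 2 by rewrite divr_gt0.
pose f (B x : R) := cos (B * x + th) * expR (- a * x ^+ 2).
have df (B' x : R) : is_derive B' 1 (f^~ x)
    (- (x * sin (B' * x + th) * expR (- a * x ^+ 2))).
  have dc := @is_derive1_comp _ (@cos R) (fun B => x * B + th) B' _ _
    (is_derive_cos _) (is_derive_affine x th B').
  have -> : f^~ x = (@cos R \o (fun B => x * B + th)) * cst (expR (- a * x ^+ 2)).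
    by apply/funext => z; rewrite /f /= fctE/= mulrC [x * z]mulrC [RHS]mulrC.
  rewrite [B' * x]mulrC in dc *.
  apply: is_derive_eq (is_deriveM dc (is_derive_cst _ _ _)) _.
  by rewrite /= /GRing.scale/=; ring.
have p1 B' x : partial1of2 f B' x = - (x * sin (B' * x + th) * expR (- a * x ^+ 2)).
  by rewrite partial1of2E; have := df B' x => -[].
pose G x : R := (1 + 2 / a) * expR (- (a / 2) * x ^+ 2).
have G0 x : 0 <= G x by rewrite mulr_ge0 ?expR_ge0// addr_ge0// divr_ge0// ltW.
have iG : lebesgue_measure.-integrable setT (EFin \o G).
  exact: integrableZl (integrable_gauss a20).
have BI : `]B - 1, B + 1[%classic B.
  by rewrite /= in_itv/= ltrBlDr ltrDl ltr01.
have int_f B' : `]B - 1, B + 1[%classic B' ->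
    lebesgue_measure.-integrable setT (EFin \o f B').
  by move=> _; exact: integrable_cos_gauss.
have der_f (B' x : R) : `]B - 1, B + 1[%classic B' -> setT x -> derivable (f^~ x) B' 1.
  by move=> _ _; have [] := df B' x.
have f_le (B' x : R) : `]B - 1, B + 1[%classic B' -> setT x ->
    `|partial1of2 f B' x| <= G x.
  by move=> _ _; rewrite p1 normrN; exact: mulx_sin_gauss_le.
split.
  exact: (derivable_under_integral measurableT BI int_f der_f G0 iG f_le).
rewrite -derive1E (differentiation_under_integral measurableT BI int_f der_f G0 iG f_le).
rewrite mulNr -Rintegral_mulx_sin_gauss// -mulN1r -RintegralZl//; last first.
  exact: integrable_mulx_sin_gauss.
by apply: eq_Rintegral => x _; rewrite p1 mulN1r.
Qed.

(** The differential equation in [B] is solved with its value at 0. Keeping a phase [th] treats the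
    cosine and the sine transforms together. *)
Lemma Rintegral_cos_gauss (R : realType) (a B th : R) : 0 < a ->
  \int[lebesgue_measure]_x (cos (B * x + th) * expR (- a * x ^+ 2)) =
  gauss_mass a * cos th * expR (- (B ^+ 2 / (4 * a))).
Proof.
move=> a0; pose F B := \int[lebesgue_measure]_x
  (cos (B * x + th) * expR (- a * x ^+ 2)).
have F0 : F 0 = gauss_mass a * cos th.
  rewrite /gauss_mass mulrC -RintegralZl//; last exact: integrable_gauss.
  by apply: eq_Rintegral => x _; rewrite mul0r add0r.
(* The integrating factor [exp(x^2 / (4 a))], written as a Gaussian of negative rate so that
   [is_derive_gauss] applies. *)
pose E x := expR (- (- (4 * a)^-1) * x ^+ 2).
have -> : - (B ^+ 2 / (4 * a)) = - (- - (4 * a)^-1 * B ^+ 2) by ring.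
rewrite expRN -F0.
suff EF : E B * F B = E 0 * F 0.
  by rewrite -[LHS](mulKf (lt0r_neq0 (expR_gt0 (- - (4 * a)^-1 * B ^+ 2)))) EF
    /E expr0n/= mulr0 expR0 mul1r mulrC.
apply: (@is_derive_0_is_cst R (E * F)) => x.
apply: is_derive_eq (is_deriveM (is_derive_gauss _ _)
  (is_derive_Rintegral_cos_gauss x th a0)) _.
rewrite /= /GRing.scale/= -/(E x) -/(F x); field.
by rewrite gt_eqF.
Qed.

(** * Gaussian integrals over the plane and the transform of a wave packet *)

Lemma measurable_shear_sq (R : realType) (m : R) :
  measurable_fun [set: R * R] (shear_sq m).
Proof.
apply: measurable_funD; apply: measurable_funX => //.
by apply: measurable_funB => //; exact: measurable_funM.
Qed.

Lemma measurable_gauss2_cos (R : realType) (a m A B th : R) :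
  measurable_fun [set: R * R]
    (fun z => expR (gauss_exponent a m z) * cos (A * z.1 + B * z.2 + th)).
Proof.
apply: measurable_funM.
  apply: measurableT_comp => //; apply: measurable_funM => //.
  exact: measurable_shear_sq.
apply: (measurableT_comp (continuous_measurable_fun (@continuous_cos R))).
by apply: measurable_funD => //; apply: measurable_funD; exact: measurable_funM.
Qed.

(** Substituting [x = y + m t] separates the variables in the Gaussian and moves the shear into the
    phase, whose slope in [t] becomes [A + m B]. *)
Lemma integral_gauss2_cos_snd (R : realType) (a m A B th t : R) : 0 < a ->
  (\int[lebesgue_measure]_x
    (expR (gauss_exponent a m (t, x)) * cos (A * t + B * x + th))%:E)%E =
  (gauss_mass a * expR (- (B ^+ 2 / (4 * a))) *
    (cos ((A + m * B) * t + th) * expR (- a * t ^+ 2)))%:E.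
Proof.
move=> a0.
pose th' := (A + m * B) * t + th.
pose h y : R := expR (- a * t ^+ 2) * (cos (B * y + th') * expR (- a * y ^+ 2)).
have ih : lebesgue_measure.-integrable setT (EFin \o h).
  exact: (integrableZl measurableT (expR (- a * t ^+ 2)) (integrable_cos_gauss B th' a0)).
transitivity (\int[lebesgue_measure]_x (EFin \o h) (x + - (m * t))%R)%E.
  apply: eq_integral => x _ /=; rewrite /h; congr (_%:E).
  rewrite [RHS]mulrCA -expRD mulrC; congr (cos _ * expR _).
    by rewrite /th'; ring.
  by rewrite /gauss_exponent /shear_sq /=; ring.
rewrite integral_lebesgue_shift; last exact: measurable_int ih.
rewrite -[LHS]fineK; last exact: integrable_fin_num.
congr (_%:E); rewrite -[LHS]/(\int[lebesgue_measure]_x h x).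
rewrite RintegralZl//; last exact: integrable_cos_gauss.
by rewrite Rintegral_cos_gauss// /th'; ring.
Qed.

Lemma integrable_gauss2_cos (R : realType) (a m A B th : R) : 0 < a ->
  (lebesgue2 R).-integrable setT
    (EFin \o (fun z : R * R =>
       expR (gauss_exponent a m z) * cos (A * z.1 + B * z.2 + th))).
Proof.
move=> a0.
have mf := measurable_gauss2_cos a m.
apply/integrable12ltyP; first by apply/measurable_EFinP; exact: mf.
apply: (@le_lt_trans _ _ (\int[lebesgue_measure]_t
    (gauss_mass a * expR (- a * t ^+ 2))%:E)%E).
  apply: ge0_le_integral => //.
  - by move=> t _; apply: integral_ge0 => x _; exact: abse_ge0.
  - apply: (@measurable_fun_fubini_tonelli_F _ _ _ _ R (@lebesgue_measure R) (fun z : R * R =>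
      `|(expR (gauss_exponent a m z) * cos (A * z.1 + B * z.2 + th))%:E|%E)) => //.
    by apply: measurableT_comp => //; apply/measurable_EFinP; exact: mf.
  - apply/measurable_EFinP/measurable_funM => //.
    by apply: measurableT_comp => //; exact: measurable_funM.
  move=> t _.
  (* The majorant is the inner integral with zero frequencies and phase, where the cosine is 1. *)
  have -> : (gauss_mass a * expR (- a * t ^+ 2))%:E =
      (\int[lebesgue_measure]_x (expR (gauss_exponent a m (t, x)) *
        cos (0 * t + 0 * x + 0))%:E)%E.
    rewrite integral_gauss2_cos_snd//; congr (_%:E).
    by rewrite !(mulr0, addr0, mul0r) cos0 mul1r expr0n/= mul0r oppr0 expR0 mulr1.
  apply: ge0_le_integral => //.
  - apply/measurable_EFinP; apply: measurableT_comp => //.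
    exact: (measurable_fun_pair2 t (mf A B th)).
  - apply/measurable_EFinP; exact: (measurable_fun_pair2 t (mf 0 0 0)).
  move=> x _; rewrite /= lee_fin normrM ger0_norm ?expR_ge0// ler_wpM2l ?expR_ge0//.
  by rewrite !mul0r !addr0 cos0 norm_cos_le1.
have := integrableZl measurableT (gauss_mass a) (integrable_gauss a0).
move=> /integrableP[_]; apply: le_lt_trans.
rewrite le_eqVlt; apply/orP; left; apply/eqP; apply: eq_integral => t _ /=.
by rewrite ger0_norm// mulr_ge0 ?expR_ge0// ltW// gauss_mass_gt0.
Qed.

Lemma Rintegral_gauss2_cos (R : realType) (a m A B th : R) : 0 < a ->
  \int[lebesgue2 R]_z
    (expR (gauss_exponent a m z) * cos (A * z.1 + B * z.2 + th)) =
  gauss_mass a ^+ 2 * cos th *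
    expR (- (((A + m * B) ^+ 2 + B ^+ 2) / (4 * a))).
Proof.
move=> a0; rewrite /Rintegral -integral12_prod_meas1; last first.
  exact: integrable_gauss2_cos.
under eq_integral do rewrite /fubini_F/= integral_gauss2_cos_snd//.
rewrite -/(\int[lebesgue_measure]_t _) RintegralZl//; last first.
  exact: integrable_cos_gauss.
rewrite Rintegral_cos_gauss//.
have -> : - (((A + m * B) ^+ 2 + B ^+ 2) / (4 * a)) =
  - (B ^+ 2 / (4 * a)) + - ((A + m * B) ^+ 2 / (4 * a)) by ring.
by rewrite expRD; ring.
Qed.

Lemma fourier2_wave_packet (R : realType) (a m al be tau xi : R) : 0 < a ->
  fourier2 (wave_packet a m al be) tau xi =
  Complex (gauss_mass a ^+ 2 * expR (-
    (((al - 2 * pi * tau + m * (be - 2 * pi * xi)) ^+ 2 +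
      (be - 2 * pi * xi) ^+ 2) / (4 * a)))) 0.
Proof.
move=> a0; rewrite /fourier2 /cintegral2; congr Complex.
  have := Rintegral_gauss2_cos m (al - 2 * pi * tau) (be - 2 * pi * xi) 0 a0.
  rewrite cos0 mulr1 => <-; apply: eq_Rintegral => -[t x] _ /=.
  rewrite mulrCA [X in _ - X]mulrCA -mulrBr -cosD; congr (_ * cos _).
  ring.
(* The imaginary part integrates a sine, that is, a cosine of phase [- pi / 2]; the formula then
   carries the factor [cos (- pi / 2) = 0]. *)
have := Rintegral_gauss2_cos m (al - 2 * pi * tau) (be - 2 * pi * xi) (- (pi / 2)) a0.
rewrite cosN cos_pihalf mulr0 mul0r => <-; apply: eq_Rintegral => -[t x] _ /=.
rewrite mulrCA [X in _ + X]mulrCA -mulrDr addrC -sinD; congr (_ * _).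
rewrite -[RHS]sinDpihalf; congr sin; ring.
Qed.

(** * Weighted norms of wave packets *)

(** The shape of a transformed wave packet: [q.1 + m * q.2 + d] and [q.2 + e] are its coordinates
    [sigma] and [eta]. *)
Definition sheared_gauss (R : realType) (K al m d e : R) (q : R * R) : R :=
  K * expR (- al * ((q.1 + m * q.2 + d) ^+ 2 + (q.2 + e) ^+ 2)).

Lemma measurable_sheared_gauss (R : realType) (K al m d e : R) :
  measurable_fun [set: R * R] (sheared_gauss K al m d e).
Proof.
apply: measurable_funM => //; apply: measurableT_comp => //.
apply: measurable_funM => //; apply: measurable_funD; apply: measurable_funX.
  apply: measurable_funD => //; apply: measurable_funD => //.
  exact: measurable_funM.
exact: measurable_funD.
Qed.

Lemma integral_sheared_gauss (R : realType) (K al m d e : R) :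
  0 <= K -> 0 < al ->
  (\int[lebesgue2 R]_q (sheared_gauss K al m d e q)%:E)%E =
  (K * gauss_mass al ^+ 2)%:E.
Proof.
move=> K0 al0.
have gE (k c : R) : (\int[lebesgue_measure]_x (k * expR (- al * (x + c) ^+ 2))%:E)%E =
    (k * gauss_mass al)%:E.
  pose h x : R := k * expR (- al * x ^+ 2).
  have ih : lebesgue_measure.-integrable setT (EFin \o h).
    exact: (integrableZl measurableT k (integrable_gauss al0)).
  rewrite (integral_lebesgue_shift (f := EFin \o h) c); last exact: measurable_int ih.
  rewrite -[LHS]fineK; last exact: integrable_fin_num.
  congr (_%:E); rewrite -[LHS]/(\int[lebesgue_measure]_x h x).
  by rewrite RintegralZl//; exact: integrable_gauss.
(* Integrating in [tau] first makes [m * xi + d] a mere translation. *)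
rewrite fubini_tonelli2/=; first last.
- by move=> q; rewrite lee_fin mulr_ge0 ?expR_ge0.
- by apply/measurable_EFinP; exact: measurable_sheared_gauss.
rewrite /fubini_G.
transitivity (\int[lebesgue_measure]_y
    ((K * gauss_mass al) * expR (- al * (y + e) ^+ 2))%:E)%E.
  apply: eq_integral => y _.
  rewrite mulrAC -(gE _ (m * y + d)); apply: eq_integral => x _.
  rewrite /sheared_gauss /= -mulrA -expRD; congr (_ * expR _)%:E; ring.
by rewrite gE -mulrA expr2.
Qed.

Lemma Lnorm2E d (T : measurableType d) (R : realType)
    (mu : {measure set T -> \bar R}) (f : T -> R) : (forall x, 0 <= f x) ->
  Lnorm mu 2%:E (EFin \o f) = ((\int[mu]_x (f x ^+ 2)%:E) `^ 2^-1)%E.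
Proof.
move=> f0; rewrite unlock; congr (_ `^ _)%E; apply: eq_integral => x _ /=.
by rewrite ger0_norm// powR_mulrn.
Qed.

Lemma le_Lnorm2 d (T : measurableType d) (R : realType)
    (mu : {measure set T -> \bar R}) (f g : T -> R) :
  measurable_fun [set: T] f -> measurable_fun [set: T] g ->
  (forall x, 0 <= f x <= g x) ->
  (Lnorm mu 2%:E (EFin \o f) <= Lnorm mu 2%:E (EFin \o g))%E.
Proof.
move=> mf mg fg.
have f0 x : 0 <= f x by have /andP[] := fg x.
have lefg x : f x <= g x by have /andP[] := fg x.
have g0 x : 0 <= g x by exact: le_trans (lefg x).
rewrite !Lnorm2E//; apply: gt0_ler_poweR => //.
- by rewrite in_itv/= leey andbT integral_ge0// => x _; rewrite lee_fin sqr_ge0.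
- by rewrite in_itv/= leey andbT integral_ge0// => x _; rewrite lee_fin sqr_ge0.
apply: ge0_le_integral => //.
- by move=> x _; rewrite lee_fin sqr_ge0.
- by apply/measurable_EFinP; exact: measurable_funX.
- by apply/measurable_EFinP; exact: measurable_funX.
by move=> x _; rewrite lee_fin ler_pXn2r// nnegrE.
Qed.

(** Squaring stays within the family. The norm does not depend on [m], [d], [e], which is what makes
    the later bounds uniform in the frequency [P]. *)
Lemma Lnorm2_sheared_gauss (R : realType) (K al m d e : R) :
  0 <= K -> 0 < al ->
  Lnorm (lebesgue2 R) 2%:E (EFin \o sheared_gauss K al m d e) =
  (K * gauss_mass (2 * al))%:E.
Proof.
move=> K0 al0; rewrite Lnorm2E; last by move=> q; rewrite mulr_ge0 ?expR_ge0.
have -> : (fun q => (sheared_gauss K al m d e q ^+ 2)%:E) =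
    (fun q => (sheared_gauss (K ^+ 2) (2 * al) m d e q)%:E).
  apply/funext => q; rewrite /sheared_gauss exprMn -expRM_natl.
  by congr (_ * expR _)%:E; ring.
rewrite integral_sheared_gauss ?sqr_ge0 ?mulr_gt0// poweR_EFin -exprMn.
by rewrite powR12_sqrt ?sqr_ge0// sqrtr_sqr ger0_norm// mulr_ge0// ltW// gauss_mass_gt0// mulr_gt0.
Qed.

Lemma bracket_ge1 (R : realType) (x : R) : 1 <= bracket x.
Proof. by rewrite -{1}[1]sqrtr1 ler_wsqrtr// lerDl sqr_ge0. Qed.

Lemma bracket_ge_norm (R : realType) (x : R) : `|x| <= bracket x.
Proof.
by rewrite -[leLHS]normr_id -sqrtr_sqr ler_wsqrtr// lerDr.
Qed.

Lemma bracket_le_1Dnorm (R : realType) (x : R) : bracket x <= 1 + `|x|.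
Proof.
rewrite -[leRHS]ger0_norm ?addr_ge0// -sqrtr_sqr ler_wsqrtr//.
by rewrite sqrrD expr1n lerD2r lerDl mul1r mulrn_wge0.
Qed.

Lemma measurable_bracket (R : realType) : measurable_fun [set: R] (@bracket R).
Proof.
apply: (measurableT_comp (continuous_measurable_fun (@sqrt_continuous R))).
apply: measurable_funD => //; apply: measurable_funX => //.
Qed.

(** Applied with [Q = sigma^2 + eta^2], it absorbs a weight of arbitrary real exponent into the
    Gaussian. Since [1 <= y], the exponent may be raised to a natural number, which also covers
    negative [be]. *)
Lemma powR_le_expR (R : realType) (be : R) :
  exists2 K : R, 0 < K & forall Q y : R, 0 <= Q -> 1 <= y <= 4 + 4 * Q ->
    y `^ be <= K * expR Q.
Proof.
pose n := (Num.trunc `|be|).+1.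
have ben : be <= n%:R.
  by apply: le_trans (ler_norm be) _; rewrite ltW// Num.Theory.truncnS_gt.
exists (4 ^+ n * (n`!%:R * expR 1)).
  by rewrite !mulr_gt0 ?exprn_gt0 ?expR_gt0 ?ltr0n ?fact_gt0.
move=> Q y Q0 => /andP[y1 yQ].
have y0 : 0 <= y by rewrite (le_trans ler01).
apply: (@le_trans _ _ (y `^ n%:R)); first exact: ler_powR.
rewrite powR_mulrn//.
apply: (@le_trans _ _ ((4 * (1 + Q)) ^+ n)).
  by rewrite ler_pXn2r ?nnegrE ?mulr_ge0 ?addr_ge0// mulrDr mulr1.
rewrite exprMn -!mulrA ler_wpM2l ?exprn_ge0// -expRD.
by rewrite exprn_le_expR// addr_ge0.
Qed.

Lemma ge0_powR_le_expR (R : realType) (be : R) :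
  exists2 K : R, 0 < K & forall Q : R, 0 <= Q -> (4 + 4 * Q) `^ be <= K * expR Q.
Proof.
have [K K0 h] := powR_le_expR be; exists K => // Q Q0.
by apply: h => //; rewrite lexx andbT; lra.
Qed.

Lemma fourier2_normc (R : realType) (a m al be tau xi : R) : 0 < a ->
  ComplexField.Normc.normc
    (fourier2 (wave_packet a m (2 * pi * al) (2 * pi * be)) tau xi) =
  sheared_gauss (gauss_mass a ^+ 2) (pi ^+ 2 / a) m (- (al + m * be)) (- be)
    (tau, xi).
Proof.
move=> a0; rewrite fourier2_wave_packet// /ComplexField.Normc.normc.
rewrite expr0n addr0 sqrtr_sqr ger0_norm; last first.
  by apply: mulr_ge0; [exact: sqr_ge0|exact: expR_ge0].
rewrite /sheared_gauss/=; congr (_ * expR _); field.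
by rewrite gt_eqF.
Qed.

Definition weighted (R : realType) (s b : R) (phi F : R * R -> R) (q : R * R) : R :=
  bracket q.2 `^ s * bracket (phi q) `^ b * F q.

Lemma measurable_weighted (R : realType) (s b : R) (phi F : R * R -> R) :
  measurable_fun [set: R * R] phi -> measurable_fun [set: R * R] F ->
  measurable_fun [set: R * R] (weighted s b phi F).
Proof.
move=> mphi mF; apply: measurable_funM => //; apply: measurable_funM.
  apply: (measurableT_comp (measurable_powR s)).
  exact: (measurableT_comp (@measurable_bracket R)).
apply: (measurableT_comp (measurable_powR b)).
exact: (measurableT_comp (@measurable_bracket R)).
Qed.

Lemma Xnorm_wave_packet (R : realType) (s b a m al be : R) : 0 < a ->
  Xnorm s b (wave_packet a m (2 * pi * al) (2 * pi * be)) =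
  Lnorm (lebesgue2 R) 2%:E (EFin \o weighted s b (fun q => q.1 + q.2 ^+ 2)
    (sheared_gauss (gauss_mass a ^+ 2) (pi ^+ 2 / a) m (- (al + m * be)) (- be))).
Proof.
move=> a0; rewrite /Xnorm; congr Lnorm; apply/funext => -[tau xi].
by rewrite -[RHS]/((_ * _ * sheared_gauss _ _ _ _ _ (tau, xi))%:E) -fourier2_normc.
Qed.

Lemma Ynorm_wave_packet (R : realType) (nu s b a m al be : R) : 0 < a ->
  Ynorm nu s b (wave_packet a m (2 * pi * al) (2 * pi * be)) =
  Lnorm (lebesgue2 R) 2%:E (EFin \o weighted s b
    (fun q => q.1 + nu * `|q.2| * q.2)
    (sheared_gauss (gauss_mass a ^+ 2) (pi ^+ 2 / a) m (- (al + m * be)) (- be))).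
Proof.
move=> a0; rewrite /Ynorm; congr Lnorm; apply/funext => -[tau xi].
by rewrite -[RHS]/((_ * _ * sheared_gauss _ _ _ _ _ (tau, xi))%:E) -fourier2_normc.
Qed.

(** * Upper bounds for the two factors *)

Lemma measurable_modulationX (R : realType) :
  measurable_fun [set: R * R] (fun q => q.1 + q.2 ^+ 2).
Proof. by apply: measurable_funD => //; apply: measurable_funX. Qed.

Lemma measurable_modulationY (R : realType) (nu : R) :
  measurable_fun [set: R * R] (fun q => q.1 + nu * `|q.2| * q.2).
Proof.
apply: measurable_funD => //; apply: measurable_funM => //.
by apply: measurable_funM => //; exact: measurableT_comp.
Qed.

(** A packet with [a = 1] has a transform of rate [pi ^+ 2] in [Q = sigma^2 + eta^2]. This leaves
    rate at least 1 after a loss of [exp Q] in the X norm or [exp(2 Q)] in the Y norm. *)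
Lemma pi_sqr_ge4 (R : realType) : 4 <= pi ^+ 2 :> R.
Proof. by have := pi_ge2 R; nra. Qed.

Lemma Xnorm_wave_packet_le (R : realType) (b : R) : exists2 K : R, 0 < K &
  forall P : R, (Xnorm 0 b
    (wave_packet 1 (2 * P) (2 * pi * - P ^+ 2) (2 * pi * P)) <= K%:E)%E.
Proof.
have [K K0 Kb] := powR_le_expR b; have M0 := gauss_mass_gt0 (@ltr01 R).
exists (K * gauss_mass 1 ^+ 2 * gauss_mass (2 * 1)).
  by rewrite !mulr_gt0 ?exprn_gt0 ?gauss_mass_gt0.
move=> P; rewrite Xnorm_wave_packet// divr1.
have := @Lnorm2_sheared_gauss R (K * gauss_mass 1 ^+ 2) 1 (2 * P)
  (- (- P ^+ 2 + 2 * P * P)) (- P).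
rewrite mulr_ge0 ?sqr_ge0 ?(ltW K0)// => /(_ isT ltr01) <-.
apply: le_Lnorm2; last first.
- move=> [tau xi]; rewrite /weighted powRr0 mul1r /sheared_gauss/=.
  set sg := tau + _ + _; set et := xi - P.
  apply/andP; split; first by rewrite mulr_ge0 ?powR_ge0// mulr_ge0 ?sqr_ge0 ?expR_ge0.
  (* In these coordinates [P] disappears from the weight, so the bound is uniform in [P]. *)
  have -> : tau + xi ^+ 2 = sg + et ^+ 2 by rewrite /sg /et; ring.
  have Q0 : 0 <= sg ^+ 2 + et ^+ 2 by rewrite addr_ge0 ?sqr_ge0.
  have := Kb (sg ^+ 2 + et ^+ 2) (bracket (sg + et ^+ 2)) Q0.
  have -> : 1 <= bracket (sg + et ^+ 2) <= 4 + 4 * (sg ^+ 2 + et ^+ 2).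
    rewrite bracket_ge1/= (le_trans (bracket_le_1Dnorm _))//.
    have h1 := ler_normD sg (et ^+ 2); have h2 := ler_norm_1Dsqr sg.
    rewrite (ger0_norm (sqr_ge0 et)) in h1; lra.
  move=> /(_ isT) h; set Q := _ + et ^+ 2 in h Q0 *.
  rewrite mulrCA -mulrA [leRHS]mulrCA ler_wpM2l ?sqr_ge0//.
  apply: (@le_trans _ _ (K * expR Q * expR (- pi ^+ 2 * Q))).
    by rewrite ler_wpM2r ?expR_ge0.
  rewrite -mulrA -expRD ler_wpM2l ?(ltW K0)// ler_expR.
  have := pi_sqr_ge4 R; nra.
- exact: measurable_sheared_gauss.
- by apply: measurable_weighted; [exact: measurable_modulationX|exact: measurable_sheared_gauss].
Qed.

(* Where nu xi > 0 the symbol nu |xi| xi differs from - xi^2 by 2 xi^2, but there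
   xi^2 <= (xi + nu N)^2. *)
Lemma benjamin_ono_modulation_le (R : realType) (nu N tau xi : R) :
  `|nu| = 1 -> 1 <= N ->
  `|tau + nu * `|xi| * xi| <=
  `|tau + 2 * (nu * N) * xi + (nu * N) ^+ 2| + 3 * (xi + nu * N) ^+ 2.
Proof.
move=> nu1 N1; pose z := nu * xi.
have nu2 : nu ^+ 2 = 1 by rewrite -(real_normK (num_real nu)) nu1 expr1n.
have xiE : `|xi| = `|z| by rewrite normrM nu1 mul1r.
have -> : nu * `|xi| * xi = `|z| * z by rewrite xiE /z; ring.
have -> : tau + `|z| * z = (tau + 2 * (nu * N) * xi + (nu * N) ^+ 2) +
    (`|z| * z + z ^+ 2 - (xi + nu * N) ^+ 2).
  have -> : z ^+ 2 = xi ^+ 2 by rewrite /z exprMn nu2 mul1r.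
  ring.
apply: le_trans (ler_normD _ _) _; rewrite lerD2l.
have -> : (xi + nu * N) ^+ 2 = (z + N) ^+ 2.
  have -> : z + N = nu * (xi + nu * N) by rewrite mulrDr mulrA -expr2 nu2 mul1r.
  by rewrite [RHS]exprMn nu2 mul1r.
have h := sqr_ge0 (z + N).
have -> : `|z| * z + z ^+ 2 - (z + N) ^+ 2 = z * (`|z| + z) - (z + N) ^+ 2 by ring.
have [z0|z0] := lerP 0 z.
  have zN : 0 <= z * N by rewrite mulr_ge0// (le_trans ler01).
  have hz := sqr_ge0 z; have hN := sqr_ge0 N.
  by rewrite (ger0_norm z0) ler_norml; apply/andP; split; nra.
by rewrite (ltr0_norm z0) addNr mulr0 add0r normrN ger0_norm//; lra.
Qed.

Lemma Ynorm_wave_packet_le (R : realType) (nu b : R) : `|nu| = 1 ->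
  exists2 K : R, 0 < K & forall N : R, 1 <= N ->
  (Ynorm nu (- (1 / 2)) b (wave_packet 1 (2 * (nu * N))
     (2 * pi * (nu * N) ^+ 2) (2 * pi * - (nu * N))) <=
   (K * N `^ (- (1 / 2)))%:E)%E.
Proof.
move=> nu1.
have [K K0 Kb] := powR_le_expR b; have M0 := gauss_mass_gt0 (@ltr01 R).
have [L L0 Lb] := ge0_powR_le_expR (1 / 2 : R).
exists (K * L * gauss_mass 1 ^+ 2 * gauss_mass (2 * 1)).
  by rewrite !mulr_gt0 ?exprn_gt0 ?gauss_mass_gt0.
move=> N N1; set P := nu * N; rewrite Ynorm_wave_packet// divr1.
have N0 : 0 < N by exact: lt_le_trans N1.
have normP : `|P| = N by rewrite normrM nu1 mul1r ger0_norm// ltW.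
have -> : - (P ^+ 2 + 2 * P * - P) = P ^+ 2 by ring.
rewrite opprK.
have := @Lnorm2_sheared_gauss R (N `^ (- (1 / 2)) * (K * L * gauss_mass 1 ^+ 2)) 1 (2 * P)
  (P ^+ 2) P.
have KL0 : 0 <= K * L by rewrite mulr_ge0// ltW.
have -> : 0 <= N `^ (- (1 / 2)) * (K * L * gauss_mass 1 ^+ 2).
  by rewrite mulr_ge0 ?powR_ge0// mulr_ge0 ?sqr_ge0.
move=> /(_ isT ltr01).
have -> : N `^ (- (1 / 2)) * (K * L * gauss_mass 1 ^+ 2) * gauss_mass (2 * 1) =
  K * L * gauss_mass 1 ^+ 2 * gauss_mass (2 * 1) * N `^ (- (1 / 2)) by ring.
move=> <-; apply: le_Lnorm2; last first.
- move=> [tau xi]; rewrite /weighted /sheared_gauss/=.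
  have := benjamin_ono_modulation_le tau xi nu1 N1; rewrite -/P.
  set sg := tau + _ + P ^+ 2; set et := xi + P => hmod.
  apply/andP; split.
    apply: mulr_ge0; first by rewrite mulr_ge0 ?powR_ge0.
    by apply: mulr_ge0; [exact: sqr_ge0|exact: expR_ge0].
  have Q0 : 0 <= sg ^+ 2 + et ^+ 2 by rewrite addr_ge0 ?sqr_ge0.
  have := Kb (sg ^+ 2 + et ^+ 2) (bracket (tau + nu * `|xi| * xi)) Q0.
  have -> : 1 <= bracket (tau + nu * `|xi| * xi) <= 4 + 4 * (sg ^+ 2 + et ^+ 2).
    rewrite bracket_ge1/= (le_trans (bracket_le_1Dnorm _))//.
    have h2 := ler_norm_1Dsqr sg; have h3 := sqr_ge0 sg; have h4 := sqr_ge0 et.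
    lra.
  move=> /(_ isT) hb.
  (* The gain [N^(-1/2)]: from [N <= |et| + |xi|] and [1 <= bracket xi] follows
     [N <= bracket xi * (4 + 4 Q)] with [Q = sg^2 + et^2], and the root of [4 + 4 Q] costs
     [L * expR Q]. *)
  have : bracket xi `^ (- (1 / 2)) <=
      N `^ (- (1 / 2)) * (L * expR (sg ^+ 2 + et ^+ 2)).
    apply: (@le_trans _ _ (N `^ (- (1 / 2)) *
        (4 + 4 * (sg ^+ 2 + et ^+ 2)) `^ (1 / 2))); last first.
      by rewrite ler_wpM2l ?powR_ge0//; exact: Lb Q0.
    rewrite !powRN [leRHS]mulrC ler_pdivlMr ?powR_gt0// [leLHS]mulrC.
    rewrite ler_pdivrMr; last first.
      by rewrite powR_gt0// (lt_le_trans ltr01)// bracket_ge1.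
    have B1 := bracket_ge1 xi.
    rewrite -powRM; [|lra|by rewrite (le_trans ler01)].
    rewrite ge0_ler_powR ?nnegrE// ?(ltW N0)//.
      by rewrite mulr_ge0//; lra.
    have hx := bracket_ge_norm xi; have he := ler_norm_1Dsqr et.
    have hN : N <= `|et| + `|xi|.
      by rewrite -normP -[P](addKr xi) addrC -/et -[`|xi|]normrN; exact: ler_normD.
    have h3 := sqr_ge0 sg; have h4 := sqr_ge0 et.
    nra.
  set Q := sg ^+ 2 + et ^+ 2 in Q0 hb * => hx.
  apply: (@le_trans _ _ ((N `^ (- (1 / 2)) * (L * expR Q)) * (K * expR Q) *
      (gauss_mass 1 ^+ 2 * expR (- pi ^+ 2 * Q)))).
    rewrite ler_wpM2r//; first by apply: mulr_ge0; [exact: sqr_ge0|exact: expR_ge0].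
    by rewrite ler_pM ?powR_ge0.
  have -> : N `^ (- (1 / 2)) * (L * expR Q) * (K * expR Q) *
      (gauss_mass 1 ^+ 2 * expR (- pi ^+ 2 * Q)) =
      N `^ (- (1 / 2)) * (K * L * gauss_mass 1 ^+ 2) * expR (Q + Q + - pi ^+ 2 * Q).
    by rewrite !expRD; ring.
  rewrite ler_wpM2l//.
    by apply: mulr_ge0; [exact: powR_ge0|apply: mulr_ge0 => //; exact: sqr_ge0].
  by rewrite ler_expR; have := pi_sqr_ge4 R; nra.
- exact: measurable_sheared_gauss.
- by apply: measurable_weighted; [exact: measurable_modulationY|exact: measurable_sheared_gauss].
Qed.

(** * The product of two packets and its lower bound *)

Lemma wave_packetM (R : realType) (a1 a2 m al1 al2 be1 be2 : R) (z : R * R) :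
  wave_packet a1 m al1 be1 z * wave_packet a2 m al2 be2 z =
  wave_packet (a1 + a2) m (al1 + al2) (be1 + be2) z.
Proof.
have E : expR (gauss_exponent (a1 + a2) m z) =
    expR (gauss_exponent a1 m z) * expR (gauss_exponent a2 m z).
  by rewrite -expRD /gauss_exponent; congr expR; ring.
have T : (al1 + al2) * z.1 + (be1 + be2) * z.2 =
  (al1 * z.1 + be1 * z.2) + (al2 * z.1 + be2 * z.2) by ring.
set th1 := al1 * z.1 + _ in T; set th2 := al2 * z.1 + _ in T.
rewrite /wave_packet E T -/th1 -/th2 (cosD th1) (sinD th1).
by apply/eqP; rewrite eq_complex /=; apply/andP; split; apply/eqP; ring.
Qed.

(** As brackets are at least 1, the exponent [b] may be lowered to [- d]. The modulation is at most
    [|P| (4 + 4 Q)] with [Q = sigma^2 + xi^2], so the weight is at least a constant times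
    [|P|^(- d) exp(- Q)]. *)
Lemma Xnorm_wave_packet_ge (R : realType) (b d : R) : 0 <= d -> - d <= b ->
  exists2 A : R, 0 < A & forall P : R, 1 <= `|P| ->
  ((A * `|P| `^ (- d))%:E <=
    Xnorm 0 b (wave_packet 2 (2 * P) (2 * pi * 0) (2 * pi * 0)))%E.
Proof.
move=> d0 db; have [K K0 Kb] := ge0_powR_le_expR d.
(* The transform has rate [pi ^+ 2 / 2], because [a = 2]; the weight adds 1. *)
pose al := 1 + pi ^+ 2 / 2 : R.
have al0 : 0 < al by rewrite addr_gt0// divr_gt0// exprn_gt0// pi_gt0.
have M0 := gauss_mass_gt0 (@ltr0Sn R 1).
exists (K^-1 * gauss_mass 2 ^+ 2 * gauss_mass (2 * al)).
  by rewrite !mulr_gt0 ?invr_gt0 ?exprn_gt0 ?gauss_mass_gt0 ?mulr_gt0.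
move=> P P1; rewrite Xnorm_wave_packet//.
have P0 : 0 < `|P| by exact: lt_le_trans P1.
have -> : - (0 + 2 * P * 0) = 0 by ring.
rewrite oppr0.
have := @Lnorm2_sheared_gauss R (`|P| `^ (- d) * (K^-1 * gauss_mass 2 ^+ 2)) al
  (2 * P) 0 0.
have G0 : 0 <= `|P| `^ (- d) * (K^-1 * gauss_mass 2 ^+ 2).
  apply: mulr_ge0; first exact: powR_ge0.
  by apply: mulr_ge0; [rewrite invr_ge0 ltW|exact: sqr_ge0].
rewrite G0 => /(_ isT al0).
have -> : `|P| `^ (- d) * (K^-1 * gauss_mass 2 ^+ 2) * gauss_mass (2 * al) =
  K^-1 * gauss_mass 2 ^+ 2 * gauss_mass (2 * al) * `|P| `^ (- d) by ring.
move=> <-; apply: le_Lnorm2; last first.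
- move=> [tau xi]; rewrite /weighted powRr0 mul1r /sheared_gauss/= !addr0.
  set sg := tau + _.
  apply/andP; split; first by apply: mulr_ge0; [exact: G0|exact: expR_ge0].
  have Q0 : 0 <= sg ^+ 2 + xi ^+ 2 by rewrite addr_ge0 ?sqr_ge0.
  have hb : bracket (tau + xi ^+ 2) <= `|P| * (4 + 4 * (sg ^+ 2 + xi ^+ 2)).
    rewrite (le_trans (bracket_le_1Dnorm _))//.
    have -> : tau + xi ^+ 2 = sg - 2 * (P * xi) + xi ^+ 2 by rewrite /sg; ring.
    have h1 := ler_normD (sg - 2 * (P * xi)) (xi ^+ 2).
    have h2 := ler_normB sg (2 * (P * xi)).
    rewrite normrM [`|P * xi|]normrM (ger0_norm (ler0n _ 2)) in h2.
    rewrite (ger0_norm (sqr_ge0 xi)) in h1.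
    have h3 := ler_norm_1Dsqr sg; have h5 := sqr_ge0 sg; have h6 := sqr_ge0 xi.
    have h4 : `|P| * (2 * `|xi|) <= `|P| * (1 + xi ^+ 2).
      rewrite ler_wpM2l// -(real_normK (num_real xi)).
      by have := sqr_ge0 (`|xi| - 1); nra.
    nra.
  set Q := sg ^+ 2 + xi ^+ 2 in Q0 hb *.
  have B1 := bracket_ge1 (tau + xi ^+ 2).
  have wb : `|P| `^ (- d) * (K^-1 * expR (- Q)) <= bracket (tau + xi ^+ 2) `^ b.
    apply: (@le_trans _ _ (bracket (tau + xi ^+ 2) `^ (- d))); last exact: ler_powR.
    apply: (@le_trans _ _ ((`|P| * (4 + 4 * Q)) `^ (- d))).
      rewrite powRM//; last lra.
      rewrite ler_wpM2l ?powR_ge0// expRN -invfM powRN lef_pV2 ?posrE.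
      - exact: Kb.
      - by rewrite mulr_gt0 ?expR_gt0.
      - by rewrite powR_gt0//; lra.
    rewrite !powRN lef_pV2 ?posrE ?powR_gt0//.
    - by rewrite ge0_ler_powR ?nnegrE// ?mulr_ge0//; lra.
    - by rewrite mulr_gt0//; lra.
    - exact: lt_le_trans B1.
  have -> : `|P| `^ (- d) * (K^-1 * gauss_mass 2 ^+ 2) * expR (- al * Q) =
      `|P| `^ (- d) * (K^-1 * expR (- Q)) *
      (gauss_mass 2 ^+ 2 * expR (- (pi ^+ 2 / 2) * Q)).
    have -> : - al * Q = - Q + - (pi ^+ 2 / 2) * Q by rewrite /al; ring.
    by rewrite expRD; ring.
  by apply: ler_wpM2r => //; apply: mulr_ge0; [exact: sqr_ge0|exact: expR_ge0].
- by apply: measurable_weighted; [exact: measurable_modulationX|exact: measurable_sheared_gauss].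
- exact: measurable_sheared_gauss.
Qed.

Theorem theorem4p3 (R : realType) (nu s s' c b b' : R)
    (hnu : `|nu| = 1) (hss' : (s, s') = (0, - (1 / 2))) (hc : 1 / 2 < c) :
  ~ (exists C : R, 0 < C /\
       forall u v : R * R -> R[i], schwartz2 u -> schwartz2 v ->
         (Xnorm s (c - 1) (fun p => u p * v p)%R <=
          C%:E * Xnorm s b u * Ynorm nu s' b' v)%E).
Proof.
case: hss' => -> -> [C [C0 bilinear]].
(* The maximum covers [c >= 1], where [1 - c] is not positive; [c > 1/2] gives [d < 1/2]. *)
pose d : R := Num.max 0 (1 - c).
have d0 : 0 <= d by rewrite le_max lexx.
have dc : - d <= c - 1 by rewrite lerNl opprB le_max lexx orbT.
have d12 : 0 < 1 / 2 - d by rewrite subr_gt0 gt_max; apply/andP; split; lra.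
have [A A0 lower] := Xnorm_wave_packet_ge d0 dc.
have [K K0 upperX] := Xnorm_wave_packet_le b.
have [L L0 upperY] := Ynorm_wave_packet_le b' hnu.
(* On the resonant pair the estimate reads [A N^(- d) <= C K L N^(-1/2)], which would bound a
   positive power of [N]. *)
have growth (N : R) : 1 <= N -> N `^ (1 / 2 - d) <= C * K * L / A.
  move=> N1; pose P := nu * N.
  have N0 : 0 < N by exact: lt_le_trans N1.
  have normP : `|P| = N by rewrite normrM hnu mul1r ger0_norm// ltW.
  have := bilinear _ _
    (wave_packet_schwartz (2 * P) (2 * pi * - P ^+ 2) (2 * pi * P) ltr01)
    (wave_packet_schwartz (2 * P) (2 * pi * P ^+ 2) (2 * pi * - P) ltr01).
  have -> : (fun p => wave_packet 1 (2 * P) (2 * pi * - P ^+ 2) (2 * pi * P) p *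
      wave_packet 1 (2 * P) (2 * pi * P ^+ 2) (2 * pi * - P) p) =
      wave_packet 2 (2 * P) (2 * pi * 0) (2 * pi * 0).
    apply/funext => z; rewrite wave_packetM; congr (wave_packet _ _ _ _ z); ring.
  have := lower P; rewrite normP => /(_ N1) lowerP upper.
  have : ((A * N `^ (- d))%:E <= (C * K * (L * N `^ (- (1 / 2))))%:E)%E.
    apply: le_trans lowerP _; apply: le_trans upper _.
    rewrite !EFinM lee_pmul ?mule_ge0 ?lee_fin ?(ltW C0) ?Lnorm_ge0//.
      by rewrite lee_pmul ?lee_fin ?(ltW C0) ?Lnorm_ge0.
    exact: upperY.
  have Nh : 0 < N `^ (1 / 2) by rewrite powR_gt0.
  have Nd : 0 < N `^ d by rewrite powR_gt0.
  rewrite lee_fin !powRN ler_pdivrMr// => h.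
  rewrite powRB; last by rewrite lt0r_neq0// implybT.
  rewrite ler_pdivlMr// mulrAC ler_pdivrMr//.
  rewrite -ler_pdivlMl//; apply: le_trans h _.
  by rewrite le_eqVlt; apply/orP; left; apply/eqP; ring.
pose T : R := C * K * L / A.
have T0 : 0 <= T by rewrite divr_ge0 ?mulr_ge0 ?ltW.
(* This [N] satisfies [N^(1/2 - d) = T + 1], which exceeds the supposed bound [T]. *)
have := growth ((T + 1) `^ (1 / 2 - d)^-1).
have -> : 1 <= (T + 1) `^ (1 / 2 - d)^-1.
  by rewrite -[leLHS](powRr0 (T + 1)) ler_powR ?invr_ge0 ?(ltW d12)// lerDr.
move=> /(_ isT); rewrite -powRrM mulVf ?lt0r_neq0// powRr1 ?addr_ge0//.
by rewrite -/T gerDl ler10.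
Qed.
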